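(* Let $T\ge 0$ be an integer, let $(\Omega,\mathcal F,\mathbb P_\pi)$ be the probability space of rollouts $\omega=(o_0,\dots,o_T)$, let $\mathcal F_t=\sigma(o_0,\dots,o_t)$ for $0\le t\le T$, and let $S:\Omega\to\{0,1\}$ be the terminal success label, which is $\mathcal F_T$-measurable. Let $r_T:=S$ and $r_t:=\mathbb E_\pi[S\mid\mathcal F_t]$ for $0\le t<T$. Consider the backward regression defined by $p_T^\star:=S$ and, for each $t=T-1,T-2,\dots,0$, $$p_t^\star\in\arg\min_{g\in L_2(\mathcal F_t)}\mathbb E_\pi\left[\left(g-p_{t+1}^\star\right)^2\right].$$ Then at each step $t<T$ the minimizer exists and is unique up to almost-sure equality, and for every $0\le t\le T$, $$p_t^\star=r_t=\mathbb E_\pi[S\mid\mathcal F_t]\quad\text{almost surely}.$$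
   Context: Let $\mathcal O$ be a measurable space (the observation space) and $T$ a fixed rollout length. $\Omega$ is the space of rollouts $\omega=(o_0,o_1,\dots,o_T)$ with each $o_t\in\mathcal O$, $\mathcal F$ is its $\sigma$-algebra of events, and $\mathbb P_\pi$ is a probability measure on $(\Omega,\mathcal F)$ (the distribution of rollouts induced by a given policy $\pi$ and the environment); $\mathbb E_\pi$ is expectation under $\mathbb P_\pi$. The trajectory prefix is $H_t=(o_0,\dots,o_t)$ and $\mathcal F_t:=\sigma(H_t)$, so $\mathcal F_t\subseteq\mathcal F_{t+1}\subseteq\mathcal F$. Each rollout carries a binary terminal success label $S\in\{0,1\}$ determined by the complete rollout, i.e. $S$ is $\mathcal F_T$-measurable. $L_2(\mathcal F_t)$ denotes the set of square-integrable, $\mathcal F_t$-measurable real random variables on $(\Omega,\mathcal F,\mathbb P_\pi)$. *)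

(* Defs.v *)
From HB Require Import structures.
From mathcomp Require Import all_boot all_order all_algebra.
From mathcomp Require Import all_classical all_reals all_analysis.

Set Implicit Arguments.
Unset Strict Implicit.
Unset Printing Implicit Defensive.

Import Order.TTheory GRing.Theory Num.Theory.
Import numFieldNormedType.Exports.

Local Open Scope classical_set_scope.
Local Open Scope ring_scope.

Section rollouts.
Context {d : measure_display} (O : measurableType d) (T : nat).

Definition rollout := T.+1.-tuple O.

(* The size is minn t.+1 T.+1, which is t.+1 for t <= T. *)
Definition history (t : nat) (w : rollout) := [tuple of take t.+1 w].

Definition history_sigma (t : nat) : set (set rollout) :=
  g_sigma_algebra_preimage (history t).

End rollouts.
Arguments history_sigma {d} O T t.

Section conditional_expectation.
Context {d : measure_display} {Omega : measurableType d} {R : realType}.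
Variable P : probability Omega R.
Implicit Types (G : set (set Omega)) (X Y g h : Omega -> R).

(* sigma(X) `<=` G; unlike measurable_fun, G need not be the canonical
   sigma-algebra of Omega. *)
Definition measurable_wrt G X := g_sigma_algebra_preimage X `<=` G.

(* Y is a version of E[X | G]: conditional expectations are determined only up
   to almost-sure equality, hence a relation rather than a function. *)
Definition is_cond_exp G X Y :=
  [/\ measurable_wrt G Y,
      P.-integrable setT (EFin \o Y) &
      forall A, G A ->
        (\int[P]_(w in A) (Y w)%:E = \int[P]_(w in A) (X w)%:E)%E].

Definition L2 G : set (Omega -> R) :=
  [set g | measurable_wrt G g /\ g \in Lfun P 2%:E].

Definition mse g Y : \bar R := 'E_P[fun w => (g w - Y w) ^+ 2].

Definition argmin_mse G Y : set (Omega -> R) :=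
  [set g | L2 G g /\ forall h, L2 G h -> (mse g Y <= mse h Y)%E].

(* The recursion carried out from time T down to time s; the full backward
   regression is s = 0.  The values p t with t < s or T < t are irrelevant. *)
Definition backward_regression (F : nat -> set (set Omega)) (T : nat)
    (S : Omega -> R) (s : nat) (p : nat -> Omega -> R) :=
  p T = S /\
  forall t, (s <= t < T)%N -> argmin_mse (F t) (p t.+1) (p t).

End conditional_expectation.

(* Main.v *)
(* For square-integrable Y, a G-measurable g minimizes E[(g - Y) ^ 2] over
   L2(G) if and only if g is a version of E[Y | G]: perturbing g by multiples of
   indicators of sets of G gives one direction, and orthogonality of g - Y to
   L2(G) the other.  Backward induction and the tower property then turn every
   p_t into a version of E[S | F_t].  Existence of E[S | F_t] comes from the
   Radon-Nikodym theorem on F_t, and its square-integrability from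
   0 <= S <= 1. *)
From HB Require Import structures.
Require Import Defs.
From mathcomp Require Import all_boot all_order all_algebra.
From mathcomp Require Import all_classical all_reals all_analysis.
From mathcomp Require Import measurable_realfun zify ring lra.

Set Implicit Arguments.
Unset Strict Implicit.
Unset Printing Implicit Defensive.

Import Order.TTheory GRing.Theory Num.Theory.
Import numFieldNormedType.Exports.

Local Open Scope classical_set_scope.
Local Open Scope ring_scope.

(** A product is positive exactly when both factors have the same strict sign. Applied to [a] and
    [- a], this splits both parts of a product of functions into nonnegative products. *)
Lemma maxr0M (R : realDomainType) (a b : R) :
  Num.max (a * b) 0 =
  Num.max a 0 * Num.max b 0 + Num.max (- a) 0 * Num.max (- b) 0.
Proof.
case: (leP a 0) => a0; case: (leP b 0) => b0; case: (leP (a * b) 0) => ab0;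
  case: (leP (- a) 0) => na0; case: (leP (- b) 0) => nb0; nra.
Qed.

(** * Measures given by a density with respect to [P] *)

Section density.
Local Open Scope ereal_scope.
Context {d : measure_display} {Omega : measurableType d} {R : realType}.
Variable P : probability Omega R.

(** Packaging [X] as a measure lets equality of integrals over sets be used as equality of
    measures. *)
Lemma ge0_density_measure (X : Omega -> \bar R) :
  (forall w, 0 <= X w) -> P.-integrable setT X ->
  exists nu : {finite_measure set Omega -> \bar R},
    [/\ forall A, nu A = \int[P]_(w in A) X w,
        nu `<< P &
        forall f : Omega -> \bar R,
          measurable_fun setT f -> (forall w, 0 <= f w) ->
          \int[nu]_w f w = \int[P]_w (f w * X w)].
Proof.
move=> X0 iX.
have ch0 A : 0 <= induced_charge iX A by apply: integral_ge0 => w _.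
pose nu0 := measure_of_charge (induced_charge iX) ch0.
have fin : fin_num_fun nu0.
  by move=> A mA; exact: (@fin_num_measure _ _ _ (induced_charge iX)).
pose finM := Measure_isFinite.Build _ _ _ nu0 fin.
pose nu : {finite_measure set Omega -> \bar R} := HB.pack nu0 finM.
have nuP : nu `<< P.
  apply/null_content_dominatesP => A mA PA0.
  apply: null_set_integral => //.
  apply: (measurable_int P).
  exact: (integrableS measurableT mA (@subsetT _ A) iX).
exists nu; split => // f mf f0.
(* The Radon-Nikodym derivative of [nu] agrees with [X] almost everywhere, since both integrate to
   [nu A] over every measurable [A]. *)
rewrite -(Radon_Nikodym_SigmaFinite.change_of_variables nuP)//.
have mX := measurable_int _ iX.
have mRN := measurable_int _ (Radon_Nikodym_SigmaFinite.f_integrable nuP).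
apply: ge0_ae_eq_integral => //.
- exact: emeasurable_funM.
- exact: emeasurable_funM.
- by move=> w _; rewrite mule_ge0// Radon_Nikodym_SigmaFinite.f_ge0.
- by move=> w _; rewrite mule_ge0.
- apply: ae_eqe_mul2l; apply: integral_ae_eq => //.
  + exact: Radon_Nikodym_SigmaFinite.f_integrable.
  + by move=> A _ mA; rewrite -Radon_Nikodym_SigmaFinite.f_integral.
Qed.

End density.

(** * Square-integrable functions on a probability space *)

Section square_integrable.
Local Open Scope ereal_scope.
Context {d : measure_display} {Omega : measurableType d} {R : realType}.
Variable P : probability Omega R.
Implicit Types (A : set Omega) (X g u v : Omega -> R).

Lemma square_integrable_Lfun2 g : measurable_fun setT g ->
  \int[P]_w ((g w) ^+ 2)%:E < +oo -> g \in Lfun P 2%:E.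
Proof.
move=> mg goo; rewrite inE; apply/andP; split; rewrite inE//=.
rewrite /finite_norm unlock /Lnorm poweR_lty//.
under eq_integral => w _ do
  rewrite /= powR_mulrn// -normrX ger0_norm ?sqr_ge0//.
exact: goo.
Qed.

Lemma bounded_Lfun2 X : measurable_fun setT X ->
  (forall w, 0 <= X w <= 1)%R -> X \in Lfun P 2%:E.
Proof.
move=> mX X01; apply: square_integrable_Lfun2 => //.
apply: (@le_lt_trans _ _ (\int[P]_w (cst 1 w))).
  apply: ge0_le_integral => //.
  - by move=> w _; rewrite lee_fin sqr_ge0.
  - by apply/measurable_EFinP; exact: measurable_funX.
  - by move=> w _; have /andP[? ?] := X01 w; rewrite lee_fin /= expr_le1.
by rewrite integral_cst// mul1e ltey_eq (fin_num_measure P).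
Qed.

Lemma Lfun2_integrable g : g \in Lfun P 2%:E -> P.-integrable setT (EFin \o g).
Proof.
move=> g2; apply/Lfun1_integrable; apply: Lfun_subset12 g2.
exact: (fin_num_measure P).
Qed.

Lemma Lfun2_indic A : measurable A -> \1_A \in Lfun P 2%:E.
Proof.
move=> mA; apply: bounded_Lfun2 => [|w]; first exact: measurable_indic.
by rewrite indicE; case: (w \in A); rewrite ?lexx ?ler01.
Qed.

Lemma expectation_sqrD u v : u \in Lfun P 2%:E -> v \in Lfun P 2%:E ->
  'E_P[(fun w => (u w + v w) ^+ 2)%R] =
  'E_P[(fun w => u w ^+ 2)%R] + 2%:E * 'E_P[u \* v] +
    'E_P[(fun w => v w ^+ 2)%R].
Proof.
move=> u2 v2.
have uu := Lfun2_mul_Lfun1 u2 u2.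
have uv := Lfun2_mul_Lfun1 u2 v2.
have vv := Lfun2_mul_Lfun1 v2 v2.
have -> : (fun w => (u w + v w) ^+ 2)%R =
    ((u \* u) \+ ((2 : R) \o* (u \* v)) \+ (v \* v))%R.
  by apply/funext => w /=; ring.
by rewrite !expectationD ?rpredD ?Lfun_scale// expectationZl.
Qed.

End square_integrable.

(** * Conditional expectation and least squares for a fixed sub-sigma-algebra *)

Section sub_sigma_algebra.
Context {d : measure_display} {Omega : measurableType d} {R : realType}.
Variable P : probability Omega R.
Variable G : set (set Omega).
Hypothesis G_sigma : sigma_algebra setT G.
Hypothesis G_measurable : G `<=` measurable.
Implicit Types (A : set Omega) (X Y f g h : Omega -> R).

Lemma measurable_g_sigmaE : (measurable : set (set (g_sigma_algebraType G))) = G.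
Proof. exact: measurable_g_measurableTypeE. Qed.

(** Passing to the type that carries [G] gives access to the closure properties of measurable
    functions. *)
Lemma measurable_wrtP X :
  measurable_wrt G X <-> measurable_fun setT (X : g_sigma_algebraType G -> R).
Proof.
split=> mX.
  by move=> _ B mB; rewrite measurable_g_sigmaE; apply: mX; exists B.
by move=> _ [B mB <-]; rewrite -measurable_g_sigmaE; apply: mX.
Qed.

Lemma measurable_id_sub :
  measurable_fun setT (idfun : Omega -> g_sigma_algebraType G).
Proof.
move=> _ A; rewrite measurable_g_sigmaE => GA.
by rewrite setTI; exact: G_measurable.
Qed.

Lemma measurable_wrt_fun X : measurable_wrt G X -> measurable_fun setT X.
Proof. by move=> mX _ B mB; apply: G_measurable; apply: mX; exists B. Qed.

Local Open Scope ereal_scope.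

(* The restriction of mu to G is its image under the identity from Omega to
   Omega equipped with the smaller sigma-algebra G. *)
Lemma sub_sigma_measure (mu : {finite_measure set Omega -> \bar R}) :
  exists nu : {finite_measure set (g_sigma_algebraType G) -> \bar R},
    [/\ forall A, nu A = mu A,
        forall f : Omega -> \bar R,
          measurable_fun setT (f : g_sigma_algebraType G -> \bar R) ->
          (forall w, 0 <= f w) -> \int[nu]_w f w = \int[mu]_w f w,
        forall f : Omega -> \bar R,
          measurable_fun setT (f : g_sigma_algebraType G -> \bar R) ->
          mu.-integrable setT f -> nu.-integrable setT f,
        forall f : Omega -> \bar R, nu.-integrable setT f ->
          mu.-integrable setT f &
        forall A (f : Omega -> \bar R), G A -> nu.-integrable setT f ->
          \int[nu]_(w in A) f w = \int[mu]_(w in A) f w].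
Proof.
pose phi : Omega -> g_sigma_algebraType G := idfun.
have mid : measurable_fun setT phi := measurable_id_sub.
have [m mE] : exists m : {measure set (g_sigma_algebraType G) -> \bar R},
    m = pushforward mu phi :> (set Omega -> \bar R).
  by unshelve eexists (pushforward mu phi : {measure set _ -> \bar R}).
have moo : m setT < +oo.
  by rewrite mE ltey_eq (fin_num_measure mu _ measurableT).
(* Restricting to [setT] leaves the values unchanged; it serves to equip [m] with the structure of a
   finite measure. *)
pose nu : {finite_measure set (g_sigma_algebraType G) -> \bar R} :=
  mfrestr measurableT moo.
have nuE : nu = pushforward mu phi :> (set Omega -> \bar R).
  by apply/funext => A; rewrite /nu/= /mfrestr /mrestr setIT mE.
have ge0E A (f : Omega -> \bar R) : G A ->
    measurable_fun setT (f : g_sigma_algebraType G -> \bar R) ->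
    (forall w, 0 <= f w) -> \int[nu]_(w in A) f w = \int[mu]_(w in A) f w.
  move=> GA mf f0.
  rewrite nuE (ge0_integral_pushforward mid)//.
    by rewrite measurable_g_sigmaE.
  exact: measurable_funTS.
have GT : G setT by rewrite -measurable_g_sigmaE; exact: measurableT.
have iE (f : Omega -> \bar R) :
    measurable_fun setT (f : g_sigma_algebraType G -> \bar R) ->
    nu.-integrable setT f <-> mu.-integrable setT f.
  move=> mf; have mF : measurable_fun setT (f : Omega -> \bar R).
    exact: (measurableT_comp mf mid).
  have absE : \int[nu]_w `|f w| = \int[mu]_w `|f w|.
    by apply: ge0E => //; exact: measurableT_comp.
  split=> /integrableP[_ foo]; apply/integrableP; split => //.
    by rewrite -absE.
  by rewrite absE.
exists nu; split.
- by move=> A; rewrite nuE.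
- by move=> f mf f0; exact: ge0E.
- by move=> f mf /iE; apply.
- by move=> f fi; apply/iE => //; exact: measurable_int fi.
- move=> A f GA fi; rewrite nuE (integral_pushforward mid)//.
  + exact: measurable_int fi.
  + apply: integrableS measurableT (G_measurable GA) _ _ => //.
    by apply/iE => //; exact: measurable_int fi.
  + by rewrite measurable_g_sigmaE.
Qed.

(** The measures with densities [X1] and [X2] coincide on [G], and the integral of a [G]-measurable
    function depends only on the restriction of the measure to [G]. *)
Lemma ge0_integralM_eq (X1 X2 f : Omega -> \bar R) :
  (forall w, 0 <= X1 w) -> (forall w, 0 <= X2 w) ->
  P.-integrable setT X1 -> P.-integrable setT X2 ->
  (forall A, G A -> \int[P]_(w in A) X1 w = \int[P]_(w in A) X2 w) ->
  measurable_fun setT (f : g_sigma_algebraType G -> \bar R) ->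
  (forall w, 0 <= f w) ->
  \int[P]_w (f w * X1 w) = \int[P]_w (f w * X2 w).
Proof.
move=> X10 X20 iX1 iX2 X12 mf f0.
have mF : measurable_fun setT (f : Omega -> \bar R).
  exact: (measurableT_comp mf measurable_id_sub).
have [nu1 [nu1E _ nu1f]] := ge0_density_measure X10 iX1.
have [nu2 [nu2E _ nu2f]] := ge0_density_measure X20 iX2.
have [m1 [m1E m1f _ _ _]] := sub_sigma_measure nu1.
have [m2 [m2E m2f _ _ _]] := sub_sigma_measure nu2.
rewrite -nu1f// -nu2f// -m1f// -m2f//.
apply: eq_measure_integral => A; rewrite measurable_g_sigmaE => GA _.
by rewrite [LHS]m1E [RHS]m2E nu1E nu2E X12.
Qed.

(** For the restriction of [P] to [G], both versions are measurable with equal integrals over every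
    measurable set, so they agree off a null set of [G], which is also [P]-null. *)
Lemma cond_exp_unique X Y1 Y2 :
  is_cond_exp P G X Y1 -> is_cond_exp P G X Y2 -> Y1 = Y2 %[ae P].
Proof.
move=> [/measurable_wrtP mY1 iY1 Y1X] [/measurable_wrtP mY2 iY2 Y2X].
have [Q [QE _ iQ _ intQ]] := sub_sigma_measure P.
have iQ1 := iQ _ ((measurable_EFinP _ _).2 mY1) iY1.
have iQ2 := iQ _ ((measurable_EFinP _ _).2 mY2) iY2.
have : ae_eq Q setT (EFin \o Y1) (EFin \o Y2).
  apply: integral_ae_eq => //; first exact: measurable_int iQ2.
  move=> A _; rewrite measurable_g_sigmaE => GA.
  by rewrite (intQ A) // (intQ A) // Y1X// Y2X.
move=> [N []]; rewrite measurable_g_sigmaE => GN QN0 Nsub.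
exists N; split; [exact: G_measurable|by rewrite -QE|].
by apply: subset_trans Nsub; apply: subsetC => w /= + _ => /(_ I) [].
Qed.

(** The version is the density, on [G], of the measure [X] dP with respect to [P]; absolute
    continuity passes to the restrictions. *)
Lemma cond_exp_exists X : measurable_fun setT X ->
  (forall w, 0 <= X w <= 1)%R -> exists g, L2 P G g /\ is_cond_exp P G X g.
Proof.
move=> mX X01.
have X0 w : (0 <= (EFin \o X) w) by rewrite lee_fin; have /andP[] := X01 w.
have iX := Lfun2_integrable (bounded_Lfun2 P mX X01).
have [nu [nuE nuP _]] := ge0_density_measure X0 iX.
have [Q [QE ge0Q _ iQP intQ]] := sub_sigma_measure P.
have [m [mE _ _ _ _]] := sub_sigma_measure nu.
have mQ : m `<< Q.
  apply/null_content_dominatesP => A; rewrite measurable_g_sigmaE => GA QA0.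
  rewrite [LHS]mE.
  apply: (null_content_dominatesP _ _).1 nuP _ (G_measurable GA) _.
  exact: etrans (esym (QE A)) QA0.
have [f [f0 ffin iQf mf]] := radon_nikodym_sigma_finite mQ.
have mGf := measurable_int _ iQf.
have iPf := iQP _ iQf.
(* The density is finite at every point, so [fine] loses nothing. *)
have fE : EFin \o (fine \o f) = f by apply/funext => w /=; rewrite fineK.
have mg : measurable_wrt G (fine \o f).
  by apply/measurable_wrtP; apply: measurableT_comp => //; exact: measurable_fine.
have fX A : G A -> \int[P]_(w in A) f w = \int[P]_(w in A) (X w)%:E.
  move=> GA; rewrite -[RHS]nuE -(intQ A)// -mf; first exact: mE.
  by rewrite measurable_g_sigmaE.
exists (fine \o f); split; last first.
  split => //; rewrite ?fE// => A GA.
  by rewrite -fX//; apply: eq_integral => w _; rewrite /= fineK.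
(* f is square-integrable: testing the defining property of the density
   against f itself gives E[f ^ 2] = E[f X] <= E[f]. *)
split => //; apply: square_integrable_Lfun2; first exact: measurable_wrt_fun.
have -> : \int[P]_w ((fine \o f) w ^+ 2)%:E = \int[P]_w (f w * f w).
  by apply: eq_integral => w _; rewrite expr2 EFinM /= fineK.
rewrite (ge0_integralM_eq (X2 := EFin \o X))//.
have mFf := measurable_int _ iPf.
apply: (@le_lt_trans _ _ (\int[P]_w f w)).
  apply: ge0_le_integral => //.
  - by move=> w _; rewrite mule_ge0.
  - by apply: emeasurable_funM => //; exact: measurable_int iX.
  - move=> w _; rewrite -[leRHS]mule1 lee_wpmul2l// lee_fin.
    by have /andP[] := X01 w.
exact: integrable_lty.
Qed.

(** Both parts of [D] have the same integrals over sets of [G], hence also against each part of [f].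
    The positive and negative parts of [f * D] then have equal integrals. *)
Lemma L2_integralM_eq0 f D : L2 P G f -> D \in Lfun P 2%:E ->
  (forall A, G A -> \int[P]_(w in A) (D w)%:E = 0) ->
  \int[P]_w (f w * D w)%:E = 0.
Proof.
move=> [/measurable_wrtP mf f2] D2 D0.
have iD := Lfun2_integrable D2.
have mD := measurable_int _ iD.
have mFf : measurable_fun setT (EFin \o f).
  by apply/measurable_EFinP; move: f2; rewrite inE => /andP[/[!inE]].
have := Lfun2_mul_Lfun1 f2 D2 => /Lfun1_integrable ifD.
(* Both integrals are finite, so the vanishing of their difference means that they are equal. *)
have eqDpn A : G A ->
    \int[P]_(w in A) (EFin \o D)^\+ w = \int[P]_(w in A) (EFin \o D)^\- w.
  move=> GA; have := D0 _ GA; rewrite integralE => /eqP.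
  have mA := G_measurable GA.
  have iDA := integrableS measurableT mA (@subsetT _ A) iD.
  have fp := integrable_fin_num mA (integrable_funepos mA iDA).
  have fn := integrable_fin_num mA (integrable_funeneg mA iDA).
  by rewrite sube_eq ?fin_num_adde_defl// add0e => /eqP.
have mGp : measurable_fun setT
    ((EFin \o f)^\+ : g_sigma_algebraType G -> \bar R).
  by apply: measurable_funepos; exact/measurable_EFinP.
have mGn : measurable_fun setT
    ((EFin \o f)^\- : g_sigma_algebraType G -> \bar R).
  by apply: measurable_funeneg; exact/measurable_EFinP.
have iDp : P.-integrable setT (EFin \o D)^\+ by exact: integrable_funepos.
have iDn : P.-integrable setT (EFin \o D)^\- by exact: integrable_funeneg.
have eqDfD := ge0_integralM_eq (funepos_ge0 _) (funeneg_ge0 _) iDp iDn eqDpn.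
have eqp := eqDfD _ mGp (funepos_ge0 _).
have eqn := eqDfD _ mGn (funeneg_ge0 _).
have posE : (EFin \o (f \* D)%R)^\+ = (fun w =>
    (EFin \o f)^\+ w * (EFin \o D)^\+ w + (EFin \o f)^\- w * (EFin \o D)^\- w).
  apply/funext => w; rewrite !funeposE !funenegE /= -!EFin_max -!EFinM -EFinD.
  by rewrite maxr0M.
have negE : (EFin \o (f \* D)%R)^\- = (fun w =>
    (EFin \o f)^\- w * (EFin \o D)^\+ w + (EFin \o f)^\+ w * (EFin \o D)^\- w).
  apply/funext => w; rewrite !funeposE !funenegE /= -!EFin_max -!EFinM -EFinD.
  (* The negative part of [f * D] is the positive part of [(- f) * D]. *)
  by rewrite -mulNr maxr0M opprK.
have mFp := measurable_funepos mFf.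
have mFn := measurable_funeneg mFf.
rewrite integralE [X in X - _](_ : _ = \int[P]_w (EFin \o (f \* D)%R)^\- w).
  rewrite subee//; apply: integrable_fin_num => //; exact: integrable_funeneg.
rewrite -[X in integral _ _ X]/(EFin \o (f \* D)%R)^\+ posE negE.
have M0 (u v : Omega -> \bar R) : (forall w, 0 <= u w) ->
    (forall w, 0 <= v w) -> forall w, setT w -> 0 <= u w * v w.
  by move=> u0 v0 w _; rewrite mule_ge0.
have mDp := measurable_funepos mD.
have mDn := measurable_funeneg mD.
rewrite !ge0_integralD//; try exact: emeasurable_funM;
  try by apply: M0 => w; rewrite ?funepos_ge0 ?funeneg_ge0.
by rewrite eqp -eqn addeC.
Qed.

Lemma L2_add f g : L2 P G f -> L2 P G g -> L2 P G (f \+ g)%R.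
Proof.
move=> [/measurable_wrtP mf f2] [/measurable_wrtP mg g2]; split.
  by apply/measurable_wrtP; exact: measurable_funD.
by rewrite rpredD ?lee1n.
Qed.

Lemma L2_sub f g : L2 P G f -> L2 P G g -> L2 P G (f \- g)%R.
Proof.
move=> [/measurable_wrtP mf f2] [/measurable_wrtP mg g2]; split.
  by apply/measurable_wrtP; exact: measurable_funB.
by rewrite rpredB ?lee1n.
Qed.

Lemma L2_scale_indic (c : R) A : G A -> L2 P G (fun w => c * \1_A w)%R.
Proof.
move=> GA; have mA := G_measurable GA; split.
  apply/measurable_wrtP; apply: measurable_funM => //.
  by apply: measurable_indic; rewrite measurable_g_sigmaE.
have -> : (fun w => c * \1_A w)%R = (c \o* \1_A)%R.
  by apply/funext => w; rewrite /= mulrC.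
by apply: Lfun_scale; [rewrite ler1n|exact: Lfun2_indic].
Qed.

Lemma argmin_mseP Y g : Y \in Lfun P 2%:E ->
  argmin_mse P G Y g <-> L2 P G g /\ is_cond_exp P G Y g.
Proof.
move=> Y2; have iY := Lfun2_integrable Y2.
(* Membership of [g] in L2(G) already gives the measurability and integrability required of a
   version, leaving only the integral identity. *)
suff H : L2 P G g -> (forall h, L2 P G h -> mse P g Y <= mse P h Y) <->
    (forall A, G A -> \int[P]_(w in A) (g w)%:E = \int[P]_(w in A) (Y w)%:E).
  split=> [[gL gmin]|[gL [_ _ gY]]]; split => //; last exact/H.
  by split; [case: gL|apply: Lfun2_integrable; case: gL|exact/H].
move=> gL; have g2 := gL.2; have ig := Lfun2_integrable g2.
pose D := (g \- Y)%R.
have D2 : D \in Lfun P 2%:E by rewrite rpredB ?lee1n.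
have iD := Lfun2_integrable D2.
have intD A : G A -> \int[P]_(w in A) (D w)%:E =
    \int[P]_(w in A) (g w)%:E - \int[P]_(w in A) (Y w)%:E.
  move=> /G_measurable mA; rewrite -integralB_EFin//.
    exact: integrableS measurableT mA (@subsetT _ A) ig.
  exact: integrableS measurableT mA (@subsetT _ A) iY.
(* Finiteness of the error of [g] is what later allows it to be cancelled from an inequality in the
   extended reals. *)
have ED2 : 'E_P[(fun w => D w ^+ 2)%R] \is a fin_num.
  by apply: expectation_fin_num; exact: Lfun2_mul_Lfun1.
have mseE u : u \in Lfun P 2%:E -> mse P (g \+ u)%R Y =
    'E_P[(fun w => u w ^+ 2)%R] + 2%:E * 'E_P[(u \* D)%R] + mse P g Y.
  move=> u2; rewrite -(expectation_sqrD u2 D2); congr expectation.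
  by apply/funext => w; rewrite /D /=; congr (_ ^+ 2)%R; ring.
have intfin f A : P.-integrable setT (EFin \o f) -> G A ->
    \int[P]_(w in A) (f w)%:E \is a fin_num.
  move=> fi /G_measurable mA; apply: integrable_fin_num => //.
  exact: integrableS measurableT mA (@subsetT _ A) fi.
split=> [gmin A GA|gY h hL]; last first.
  have uL := L2_sub hL gL.
  (* The cross term vanishes by orthogonality, so the error of [h] exceeds that of [g] by
     E[(h - g) ^ 2]. *)
  have -> : h = (g \+ (h \- g))%R by apply/funext => w /=; ring.
  rewrite mseE; last by case: uL.
  have -> : 'E_P[((h \- g) \* D)%R] = 0.
    rewrite unlock; apply: (L2_integralM_eq0 uL D2) => A GA.
    by rewrite intD// gY// subee// intfin.
  by rewrite mule0 adde0 leeDr// expectation_ge0// => w; rewrite sqr_ge0.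
have mA := G_measurable GA.
suff D0 : \int[P]_(w in A) (D w)%:E = 0.
  move/eqP: D0; rewrite intD// sube_eq ?fin_num_adde_defl ?intfin//.
  by rewrite add0e => /eqP.
(* Moving g by - c 1_A, with c the integral of D over A, changes the error by
   c ^ 2 (P A - 2), which is negative unless c = 0. *)
set c := fine (\int[P]_(w in A) (D w)%:E).
have cE : \int[P]_(w in A) (D w)%:E = c%:E by rewrite fineK ?intfin.
pose a := fine (P A).
have aE : P A = a%:E by rewrite fineK// fin_num_measure.
have a1 : (a <= 1)%R by rewrite -lee_fin -aE probability_le1.
pose u := (fun w => - c * \1_A w)%R.
have uL : L2 P G u := L2_scale_indic (- c) GA.
have := gmin _ (L2_add gL uL); rewrite mseE; last by case: uL.
have -> : 'E_P[(fun w => u w ^+ 2)%R] = (c ^+ 2 * a)%:E.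
  have -> : (fun w => u w ^+ 2)%R = ((c ^+ 2)%R \o* \1_A)%R.
    by apply/funext => w; rewrite /u /= indicE; case: (w \in A) => /=; ring.
  rewrite expectationZl; first by rewrite expectation_indic// aE.
  by apply/Lfun1_integrable; apply/integrable_indic; rewrite ?setIT.
have -> : 'E_P[(u \* D)%R] = (- c ^+ 2)%:E.
  have -> : (u \* D)%R = ((- c)%R \o* (D \* \1_A))%R.
    by apply/funext => w; rewrite /u /=; ring.
  rewrite expectationZl; last first.
    by apply: Lfun2_mul_Lfun1 => //; exact: Lfun2_indic.
  rewrite unlock (_ : \int[P]_w _ = c%:E); first by rewrite -EFinM expr2 mulNr.
  rewrite -cE [RHS]integral_mkcond; apply: eq_integral => w _.
  by rewrite patchE /= indicE; case: ifP => _; rewrite ?mulr1 ?mulr0.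
have Efin : mse P g Y \is a fin_num by exact: ED2.
rewrite -EFinM -EFinD -[X in X <= _]add0e leeD2rE// lee_fin => c0.
rewrite cE; congr (_%:E); apply/eqP; rewrite -sqrf_eq0 eq_le sqr_ge0 andbT.
have := sqr_ge0 c; nra.
Qed.

End sub_sigma_algebra.

(** * Backward induction along a filtration *)

Section backward.
Context {d : measure_display} {Omega : measurableType d} {R : realType}.
Variables (P : probability Omega R) (T : nat) (F : nat -> set (set Omega)).
Hypothesis F_sigma : forall t, (t <= T)%N -> sigma_algebra setT (F t).
Hypothesis F_measurable : forall t, (t <= T)%N -> F t `<=` measurable.
Hypothesis F_mono : forall t, (t < T)%N -> F t `<=` F t.+1.
Variable S : Omega -> R.
Hypothesis S01 : forall w, 0 <= S w <= 1.
Hypothesis S_terminal : measurable_wrt (F T) S.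
Implicit Types p : nat -> Omega -> R.

Let mS : measurable_fun setT S.
Proof. exact: (measurable_wrt_fun (F_measurable (leqnn T))). Qed.

(** Tower property in integral form: over a set of [F u], which also lies in [F u.+1], the integrals
    of [p u], [p u.+1] and [S] agree. Square-integrability is carried along because [argmin_mseP]
    asks it of the next target. A general [s] covers a regression stopped just before the step under
    study. *)
Lemma backward_regression_cond_exp s p :
  backward_regression P F T S s p -> forall t, (s <= t <= T)%N ->
  p t \in Lfun P 2%:E /\ is_cond_exp P (F t) S (p t).
Proof.
move=> [pT pmin] t /andP[st tT].
(* The induction is on the number [T - t] of backward steps; its two bounds keep the index at least
   [s] and the subtraction from [T] untruncated. *)
rewrite -(subKn tT); have := leq_subr t T.
have : (T - t <= T - s)%N by rewrite leq_sub2l.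
elim: (T - t)%N => [_ _|k IH kT kT'].
  rewrite subn0 pT; have S2 := bounded_Lfun2 P mS S01.
  by split => //; split => //; exact: Lfun2_integrable.
have [IH2 [_ _ IHS]] := IH (ltnW kT) (ltnW kT').
set u := (T - k.+1)%N; have uE : (T - k = u.+1)%N by rewrite /u subnSK.
have uT : (u < T)%N by rewrite /u; lia.
rewrite uE in IH2 IHS.
have us : (s <= u)%N by rewrite /u; lia.
have := pmin u; rewrite us uT => /(_ isT).
move=> /(argmin_mseP (F_sigma (ltnW uT)) (F_measurable (ltnW uT)) _ IH2).
move=> [[mpu pu2] [_ ipu puE]]; split => //; split => // A FA.
by rewrite puE// IHS//; exact: F_mono.
Qed.

(** The minimizer is built from [S], not from [p t.+1], which need not take values in [0, 1]
    everywhere; both have the same integrals over sets of [F t]. *)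
Lemma argmin_mse_exists t p : (t < T)%N ->
  backward_regression P F T S t.+1 p ->
  exists g, argmin_mse P (F t) (p t.+1) g.
Proof.
move=> tT pmin.
have [p2 [_ _ pS]] :=
  backward_regression_cond_exp pmin (introT andP (conj (leqnn _) tT)).
have Ft := F_sigma (ltnW tT); have mFt := F_measurable (ltnW tT).
have [g [gL [mg ig gS]]] := cond_exp_exists P Ft mFt mS S01.
exists g; apply/(argmin_mseP Ft mFt _ p2); split => //; split => // A FA.
by rewrite gS// pS//; exact: F_mono.
Qed.

Lemma argmin_mse_unique t p g h : (t < T)%N ->
  backward_regression P F T S t.+1 p ->
  argmin_mse P (F t) (p t.+1) g -> argmin_mse P (F t) (p t.+1) h ->
  g = h %[ae P].
Proof.
move=> tT pmin.
have [p2 _] :=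
  backward_regression_cond_exp pmin (introT andP (conj (leqnn _) tT)).
have Ft := F_sigma (ltnW tT); have mFt := F_measurable (ltnW tT).
move=> /(argmin_mseP Ft mFt _ p2)[_ gE] /(argmin_mseP Ft mFt _ p2)[_ hE].
exact: cond_exp_unique gE hE.
Qed.

End backward.

(** * The filtration generated by trajectory prefixes *)

Lemma sigma_algebra_history d (O : measurableType d) T t :
  sigma_algebra setT (history_sigma O T t).
Proof. exact/sigma_algebra_preimage/sigma_algebra_measurable. Qed.

(** Each coordinate of the shorter prefix is a coordinate of the longer one, so the shorter prefix
    is a measurable function of the longer. *)
Lemma history_sigma_mono d (O : measurableType d) T s t : (s <= t)%N ->
  history_sigma O T s `<=` history_sigma O T t.
Proof.
move=> st.
have mt : measurable_fun setT
    (history t : g_sigma_algebra_preimageType (@history d O T t) -> _).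
  by move=> _ B mB; exists B.
suff ms : measurable_fun setT
    (history s : g_sigma_algebra_preimageType (@history d O T t) -> _).
  by move=> _ [B mB <-]; exact: ms.
apply/measurable_fun_tnthP => i.
have le_min : (minn s.+1 T.+1 <= minn t.+1 T.+1)%N by lia.
rewrite (_ : _ \o _ = (@tnth _ O)^~ (widen_ord le_min i) \o history t).
  exact: measurableT_comp (measurable_tnth _) mt.
(* The index lies within both prefixes, so the default [point] is never read. *)
apply/funext => w /=; rewrite !(tnth_nth point)/= !nth_take//.
all: by have := ltn_ord i; lia.
Qed.

Theorem theorem2 (R : realType) (d : measure_display) (O : measurableType d)
    (T : nat)
    (F : set (set (rollout O T)))
    (F_sigma : sigma_algebra setT F)
    (F_history : forall t, (t <= T)%N -> history_sigma O T t `<=` F)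
    (P : probability (g_sigma_algebraType F) R)
    (S : g_sigma_algebraType F -> R)
    (S_binary : forall w, S w = 0 \/ S w = 1)
    (S_terminal : measurable_wrt (history_sigma O T T) S) :
  (forall (t : nat) (p : nat -> g_sigma_algebraType F -> R),
    (t < T)%N ->
    backward_regression P (history_sigma O T) T S t.+1 p ->
    (exists g, argmin_mse P (history_sigma O T t) (p t.+1) g) /\
    (forall g h,
      argmin_mse P (history_sigma O T t) (p t.+1) g ->
      argmin_mse P (history_sigma O T t) (p t.+1) h ->
      g = h %[ae P])) /\
  (forall p : nat -> g_sigma_algebraType F -> R,
    backward_regression P (history_sigma O T) T S 0 p ->
    (forall t, (t <= T)%N -> is_cond_exp P (history_sigma O T t) S (p t)) /\
    (forall r : nat -> g_sigma_algebraType F -> R,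
      r T = S ->
      (forall t, (t < T)%N -> is_cond_exp P (history_sigma O T t) S (r t)) ->
      forall t, (t <= T)%N ->
        p t = r t %[ae P] /\ is_cond_exp P (history_sigma O T t) S (r t))).
Proof.
have FE : (measurable : set (set (g_sigma_algebraType F))) = F.
  exact: measurable_g_measurableTypeE.
have F_meas t : (t <= T)%N ->
    history_sigma O T t `<=` (measurable : set (set (g_sigma_algebraType F))).
  by move=> tT; rewrite FE; exact: F_history.
have F_alg t (_ : (t <= T)%N) := sigma_algebra_history O T t.
have F_mono t (_ : (t < T)%N) := @history_sigma_mono _ O T _ _ (leqnSn t).
have S01 w : 0 <= S w <= 1 by case: (S_binary w) => ->; rewrite ?lexx ?ler01.
split=> [t p tT pmin|p pmin].
  split=> [|g h].
    exact: (argmin_mse_exists (Omega := g_sigma_algebraType F)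
      F_alg F_meas F_mono S01 S_terminal tT pmin).
  exact: (argmin_mse_unique (Omega := g_sigma_algebraType F)
    F_alg F_meas F_mono S01 S_terminal tT pmin).
have pE t : (t <= T)%N -> is_cond_exp P (history_sigma O T t) S (p t).
  (* With [s] equal to 0 the lower bound computes to true, so [tT] serves as the double
     inequality. *)
  move=> tT; exact: (backward_regression_cond_exp
    (Omega := g_sigma_algebraType F)
    F_alg F_meas F_mono S01 S_terminal pmin tT).2.
split=> // r rT rE t tT.
have rtE : is_cond_exp P (history_sigma O T t) S (r t).
  move: tT; rewrite leq_eqVlt => /predU1P[->|/rE//].
  (* At the terminal time both [r T] and [p T] are [S] itself. *)
  by rewrite rT; have := pE T (leqnn T); rewrite pmin.1.
split=> //; exact: (cond_exp_unique (Omega := g_sigma_algebraType F)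
  (F_alg _ tT) (F_meas _ tT) (pE _ tT) rtE).
Qed.
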